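(* Let $\Phi\in\mathbb{R}^{n_y\times q}$ be an unknown constant matrix and let the outputs $y(k)\in\mathbb{R}^{n_y}$ be generated by $$y(k)=\Phi\,\zeta(k)+\omega(k),$$ where $\zeta(k)=\zeta(U_{stf}(k),\alpha(k))\in\mathbb{R}^q$ is the known regressor and $\omega(k)\in\mathbb{R}^{n_y}$ is an unknown disturbance with $\|\omega(k)\|\le\varepsilon$ for all $k$. Let the identified model be $\hat y(k)=\hat\Phi(k)\,\zeta(k)$ with $\hat\Phi(k)\in\mathbb{R}^{n_y\times q}$, and let $\tilde\Phi(k)=\hat\Phi(k)-\Phi$. Let $k_1,\dots,k_s$ be past recording time steps, and suppose that the history stack $Z=[\zeta(k_1),\dots,\zeta(k_s)]\in\mathbb{R}^{q\times s}$ satisfies $\operatorname{rank}(Z)=q$. Consider the update law $$\hat\Phi(k+1)=\hat\Phi(k)-\bar e_{si}(k)\,\bar\zeta^T(k)\,\Omega-\sum_{j=1}^{s}\bar e_{si}(k_j)\,\bar\zeta^T(k_j)\,\Omega,$$ with learning rate matrix $\Omega=r I_q$, where the scalar $r$ satisfies, at every time step $k$ of the update, $$0<r<\frac{2\lambda_{\min}(H_2)}{\lambda_{\max}^2(H_2)},\qquad H_2=H_2(k)=\bar\zeta(k)\bar\zeta^T(k)+\sum_{j=1}^{s}\bar\zeta(k_j)\bar\zeta^T(k_j).$$ Then: (i) if $\omega(k)=0$ for all $k$ (including the recording time steps), the parameter identification error $\tilde\Phi(k)$ converges to zero as $k\to\infty$; (ii) if $\omega(k)\neq0$, the parameter identification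 error $\tilde\Phi(k)$ is uniformly ultimately bounded.
   Context: Regressor structure. The model is a composite of $L$ local linear models: $y(k)=\sum_{i=1}^L\alpha_i(k)\,(A_iU_{stf}(k)+b_i+\omega_i(k))$, where $U_{stf}(k)\in\mathbb{R}^{n_U}$ collects finitely many past inputs and outputs, $\alpha_i(k)>0$ are known interpolation weights (softmax-like, $\sum_i\alpha_i(k)=1$), $A_i\in\mathbb{R}^{n_y\times n_U}$, $b_i\in\mathbb{R}^{n_y}$, and $\omega_i(k)\in\mathbb{R}^{n_y}$ are bounded unknown disturbances, $\|\omega_i(k)\|\le\varepsilon_i$. One sets $q=L(n_U+1)$, $\Phi=[A_1,b_1,\dots,A_L,b_L]$, $\zeta(k)=[\alpha_1(k)U_{stf}^T(k),\alpha_1(k),\dots,\alpha_L(k)U_{stf}^T(k),\alpha_L(k)]^T\in\mathbb{R}^q$ and $\omega(k)=\sum_i\alpha_i(k)\omega_i(k)$. Normalization. Fix $\varrho>0$ and let $m(k)=\sqrt{\varrho+\zeta(k)^T\zeta(k)}$, $\bar\zeta(k)=\zeta(k)/m(k)$, $\bar\omega(k)=\omega(k)/m(k)$ (likewise at the recorded times $k_j$). Errors. At the current time $k$, the normalized identification errors, both evaluated with the current estimate $\hat\Phi(k)$, are $\bar e_{si}(k)=(\hat\Phi(k)\zeta(k)-y(k))/m(k)=\tilde\Phi(k)\bar\zeta(k)-\bar\omega(k)$ and $\bar e_{si}(k_j)=(\hat\Phi(k)\zeta(k_j)-y(k_j))/m(k_j)=\tilde\Phi(k)\bar\zeta(k_j)-\bar\omega(k_j)$,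 $j=1,\dots,s$. $\lambda_{\min},\lambda_{\max}$ denote the smallest and largest eigenvalues; $\|\cdot\|$ is the Euclidean norm of a vector or the induced 2-norm of a matrix; $I_q$ is the $q\times q$ identity. Uniformly ultimately bounded has the standard meaning: there is a $b>0$ such that for every $a>0$ there is a time $T(a)$, independent of the initial time $k_0$, with $\|\tilde\Phi(k_0)\|\le a$ implying $\|\tilde\Phi(k)\|\le b$ for all $k\ge k_0+T(a)$. *)

(* Defs.v *)
From mathcomp Require Export all_boot all_order all_algebra.
From mathcomp Require Export all_classical all_reals all_analysis.
Export Order.TTheory GRing.Theory Num.Theory.
Export numFieldNormedType.Exports.

Set Implicit Arguments.
Unset Strict Implicit.
Unset Printing Implicit Defensive.

Local Open Scope classical_set_scope.
Local Open Scope ring_scope.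

(* The library norm on matrices is the max norm, hence the definitions of the
   Euclidean norm and of the norm it induces. *)
Definition vnorm2 (R : realType) (n : nat) (v : 'cV[R]_n) : R :=
  Num.sqrt (\sum_i v i 0 ^+ 2).

Definition mxnorm2 (R : realType) (m n : nat) (A : 'M[R]_(m, n)) : R :=
  sup [set vnorm2 (A *m x) | x in [set x : 'cV[R]_n | vnorm2 x <= 1]].

(* A matrix has finitely many eigenvalues, so the sup and inf are attained as
   soon as there is a real one, e.g., for symmetric matrices of positive size. *)
Definition lambda_max (R : realType) (n : nat) (H : 'M[R]_n) : R :=
  sup [set a | eigenvalue H a].

Definition lambda_min (R : realType) (n : nat) (H : 'M[R]_n) : R :=
  inf [set a | eigenvalue H a].

(* The column vector [a_1 u^T, a_1, ..., a_L u^T, a_L]^T: mxvec concatenates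
   the rows of a matrix, here the L rows [a_i u^T, a_i]. *)
Definition regressor (R : realType) (L nU : nat) (a : 'I_L -> R)
    (u : 'cV[R]_nU) : 'cV[R]_(L * (nU + 1)) :=
  (mxvec (\matrix_(i < L) row_mx (a i *: u^T) (a i)%:M))^T.

Definition normalizer (R : realType) (q : nat) (rho : R) (z : 'cV[R]_q) : R :=
  Num.sqrt (rho + (z^T *m z) 0 0).

Definition normalized (R : realType) (q : nat) (rho : R) (z : 'cV[R]_q) :
    'cV[R]_q :=
  (normalizer rho z)^-1 *: z.

(* The normalized identification error of the estimate P at a time where the
   regressor is z and the measured output is w. *)
Definition ident_error (R : realType) (ny q : nat) (rho : R)
    (P : 'M[R]_(ny, q)) (z : 'cV[R]_q) (w : 'cV[R]_ny) : 'cV[R]_ny :=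
  (normalizer rho z)^-1 *: (P *m z - w).

Definition history_stack (R : realType) (q s : nat) (zeta : nat -> 'cV[R]_q)
    (krec : 'I_s -> nat) : 'M[R]_(q, s) :=
  \matrix_(i < q, j < s) zeta (krec j) i 0.

Definition H2 (R : realType) (q s : nat) (rho : R) (zeta : nat -> 'cV[R]_q)
    (krec : 'I_s -> nat) (k : nat) : 'M[R]_q :=
  let zb t := normalized rho (zeta t) in
  zb k *m (zb k)^T + \sum_(j < s) zb (krec j) *m (zb (krec j))^T.

Definition update_law (R : realType) (ny q s : nat) (rho : R)
    (zeta : nat -> 'cV[R]_q) (y : nat -> 'cV[R]_ny) (krec : 'I_s -> nat)
    (Omega : 'M[R]_q) (k0 : nat) (Phihat : nat -> 'M[R]_(ny, q)) : Prop :=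
  let zb t := normalized rho (zeta t) in
  (* the errors at the recorded times also use the current estimate *)
  let e k t := ident_error rho (Phihat k) (zeta t) (y t) in
  forall k, (k0 <= k)%N ->
    Phihat k.+1 = Phihat k - e k k *m (zb k)^T *m Omega
      - \sum_(j < s) e k (krec j) *m (zb (krec j))^T *m Omega.

(* The property of a time-varying system whose solutions started at time k0
   are the X with sol k0 X; the bound b and the delay T are uniform over all
   admissible initial times (from K on) and all solutions. *)
Definition uniformly_ultimately_bounded (R : realType) (m n : nat) (K : nat)
    (sol : nat -> (nat -> 'M[R]_(m, n)) -> Prop) : Prop :=
  exists2 b : R, 0 < b &
    forall a : R, 0 < a -> exists T : nat,
      forall (k0 : nat) (X : nat -> 'M[R]_(m, n)), (K <= k0)%N -> sol k0 X ->
        mxnorm2 (X k0) <= a ->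
        forall k, (k0 + T <= k)%N -> mxnorm2 (X k) <= b.

(* Main.v *)
Require Import Defs.
From mathcomp Require Import ring lra.

(* The estimation error X satisfies X(k+1) = X(k) (1 - r H2(k)) + N(k), where
   N(k) is a bounded noise, so it suffices that the maps X |-> X (1 - r H2(k))
   contract the Frobenius norm by a factor bounded away from 1 uniformly in k.
   Since H2(k) is the sum of the fixed positive definite matrix S of the history
   stack and of a rank one matrix, its eigenvalues are at least
   lambda_min(S) > 0.  The pointwise condition on r could a priori let
   r * lambda_max(H2(k)) tend to 2; this is excluded by interlacing: in
   dimension at least 2, lambda_min(H2(k)) <= sigma <= lambda_max(H2(k)) with
   sigma = lambda_max(S), hence r * sigma < 2 and
   (r * lambda_max(H2(k)))^2 < 2 * r * sigma < 4.  In dimension 1 the weights sum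
   to 1 and the regressor is constant, so H2(k) does not depend on k. *)

Set Implicit Arguments.
Unset Strict Implicit.
Unset Printing Implicit Defensive.

Local Open Scope classical_set_scope.
Local Open Scope ring_scope.

(** * The Frobenius inner product *)

Definition mxdot (R : comNzRingType) (m n : nat) (A B : 'M[R]_(m, n)) : R :=
  \tr (A *m B^T).

Lemma mxdotE (R : comNzRingType) (m n : nat) (A B : 'M[R]_(m, n)) :
  mxdot A B = \sum_i \sum_j A i j * B i j.
Proof.
by apply: eq_bigr => i _; rewrite mxE; apply: eq_bigr => j _; rewrite mxE.
Qed.

Lemma mxdotC (R : comNzRingType) (m n : nat) (A B : 'M[R]_(m, n)) :
  mxdot A B = mxdot B A.
Proof. by rewrite /mxdot -mxtrace_tr trmx_mul trmxK. Qed.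

Lemma mxdotDl (R : comNzRingType) (m n : nat) (A B C : 'M[R]_(m, n)) :
  mxdot (A + B) C = mxdot A C + mxdot B C.
Proof. by rewrite /mxdot mulmxDl mxtraceD. Qed.

Lemma mxdotZl (R : comNzRingType) (m n : nat) (a : R) (A B : 'M[R]_(m, n)) :
  mxdot (a *: A) B = a * mxdot A B.
Proof. by rewrite /mxdot -scalemxAl mxtraceZ. Qed.

Lemma mxdotDr (R : comNzRingType) (m n : nat) (A B C : 'M[R]_(m, n)) :
  mxdot A (B + C) = mxdot A B + mxdot A C.
Proof. by rewrite mxdotC mxdotDl !(mxdotC A). Qed.

Lemma mxdotZr (R : comNzRingType) (m n : nat) (a : R) (A B : 'M[R]_(m, n)) :
  mxdot A (a *: B) = a * mxdot A B.
Proof. by rewrite mxdotC mxdotZl mxdotC. Qed.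

(** Adjointness of right multiplication. For a row [x] and a symmetric [H], [mxdot (x *m H) x] is
    the quadratic form of [H] at [x]. *)
Lemma mxdotMl (R : comNzRingType) (m n p : nat) (A : 'M[R]_(m, n))
    (B : 'M[R]_(m, p)) (H : 'M[R]_(n, p)) :
  mxdot (A *m H) B = mxdot A (B *m H^T).
Proof. by rewrite /mxdot trmx_mul trmxK mulmxA. Qed.

Lemma mxdot_rows (R : comNzRingType) (m n : nat) (A B : 'M[R]_(m, n)) :
  mxdot A B = \sum_i mxdot (row i A) (row i B).
Proof.
rewrite mxdotE; apply: eq_bigr => i _; rewrite mxdotE big_ord1.
by apply: eq_bigr => j _; rewrite !mxE.
Qed.

Lemma mxdot_ge0 (R : realDomainType) (m n : nat) (A : 'M[R]_(m, n)) :
  0 <= mxdot A A.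
Proof.
by rewrite mxdotE; do 2![apply: sumr_ge0 => ? _]; rewrite -expr2 sqr_ge0.
Qed.

Lemma sqr_entry_le (R : realDomainType) (m n : nat) (A : 'M[R]_(m, n)) i j :
  A i j ^+ 2 <= mxdot A A.
Proof.
rewrite mxdotE (bigD1 i) //= (bigD1 j) //= -expr2 -addrA lerDl addr_ge0 //.
  by apply: sumr_ge0 => ? _; rewrite -expr2 sqr_ge0.
by do 2![apply: sumr_ge0 => ? _]; rewrite -expr2 sqr_ge0.
Qed.

Lemma mxdot_eq0 (R : realDomainType) (m n : nat) (A : 'M[R]_(m, n)) :
  (mxdot A A == 0) = (A == 0).
Proof.
apply/eqP/eqP => [A0|->]; last by rewrite /mxdot mul0mx mxtrace0.
apply/matrixP => i j; rewrite mxE; apply/eqP; rewrite -sqrf_eq0.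
by rewrite eq_le sqr_ge0 -A0 sqr_entry_le.
Qed.

Lemma mxdot_gt0 (R : realDomainType) (m n : nat) (A : 'M[R]_(m, n)) :
  (0 < mxdot A A) = (A != 0).
Proof. by rewrite lt_def mxdot_ge0 mxdot_eq0 andbT. Qed.

(** * Cauchy-Schwarz inequalities for semidefinite forms *)

Lemma psd_cauchy_schwarz (R : realFieldType) (n : nat) (H : 'M[R]_n)
    (x y : 'rV[R]_n) :
    H^T = H -> (forall z : 'rV[R]_n, 0 <= mxdot (z *m H) z) ->
  mxdot (x *m H) y ^+ 2 <= mxdot (x *m H) x * mxdot (y *m H) y.
Proof.
move=> symH psdH.
have yxE : mxdot (y *m H) x = mxdot (x *m H) y by rewrite mxdotMl symH mxdotC.
have expand s t : mxdot ((s *: x + t *: y) *m H) (s *: x + t *: y) =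
    s ^+ 2 * mxdot (x *m H) x + 2 * s * t * mxdot (x *m H) y +
    t ^+ 2 * mxdot (y *m H) y.
  rewrite mulmxDl -!scalemxAl !(mxdotDl, mxdotDr, mxdotZl, mxdotZr) yxE.
  by ring.
have := psdH x; have := psdH y; move: expand.
set a := mxdot (x *m H) x; set b := mxdot (x *m H) y.
set c := mxdot (y *m H) y => expand c0 a0.
have [c_eq0|c_neq0] := eqVneq c 0.
  have [->|b_neq0] := eqVneq b 0; first by rewrite expr0n mulr_ge0.
  (* Along [x + t *: y] the form is now affine in [t], namely [a + 2 * b * t]; this choice of [t]
     makes it -1. *)
  have := psdH (1 *: x + (- (a + 1) / (2 * b)) *: y); rewrite expand c_eq0.
  have -> : 1 ^+ 2 * a + 2 * 1 * (- (a + 1) / (2 * b)) * b +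
    (- (a + 1) / (2 * b)) ^+ 2 * 0 = -1 by field.
  by rewrite lerNr oppr0 ler10.
(* Up to scaling, this is the minimizer of the form along [x + t *: y]. *)
have := psdH (c *: x + (- b) *: y); rewrite expand.
have -> : c ^+ 2 * a + 2 * c * - b * b + (- b) ^+ 2 * c = c * (a * c - b ^+ 2).
  by ring.
by rewrite pmulr_rge0 ?subr_ge0 // lt_def c_neq0.
Qed.

Lemma cauchy_schwarz_row (R : realFieldType) (n : nat) (x y : 'rV[R]_n) :
  mxdot x y ^+ 2 <= mxdot x x * mxdot y y.
Proof.
have := @psd_cauchy_schwarz _ _ 1%:M x y (trmx1 _ _); rewrite !mulmx1; apply.
by move=> z; rewrite mulmx1 mxdot_ge0.
Qed.

(** Each entry of [x *m B] is the inner product of [x] with a column of [B]; Cauchy-Schwarz is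
    applied to each and summed. *)
Lemma mxdot_mulmx_le (R : realFieldType) (n p : nat) (x : 'rV[R]_n)
    (B : 'M[R]_(n, p)) :
  mxdot (x *m B) (x *m B) <= mxdot B B * mxdot x x.
Proof.
have trE (m q : nat) (A : 'M[R]_(m, q)) : mxdot A A = mxdot A^T A^T.
  by rewrite /mxdot trmxK mxtrace_mulC.
rewrite (trE _ _ B) (mxdot_rows B^T) mxdotE big_ord1 mulr_suml.
apply: ler_sum => j _; rewrite -expr2 mulrC.
suff -> : (x *m B) 0 j = mxdot x (row j B^T) by apply: cauchy_schwarz_row.
by rewrite mxdotE big_ord1 mxE; apply: eq_bigr => i _; rewrite !mxE.
Qed.

(** This is the operator inequality H^2 <= M H. Cauchy-Schwarz for the form of [H] at [x] and
    [x *m H] gives |xH|^4 <= (form at x) * M |xH|^2, and |xH|^2 is cancelled. *)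
Lemma psd_sqr_le (R : realFieldType) (n : nat) (H : 'M[R]_n) (M : R)
    (x : 'rV[R]_n) :
    H^T = H -> (forall z : 'rV[R]_n, 0 <= mxdot (z *m H) z) -> 0 <= M ->
    (forall z : 'rV[R]_n, mxdot (z *m H) z <= M * mxdot z z) ->
  mxdot (x *m H) (x *m H) <= M * mxdot (x *m H) x.
Proof.
move=> symH psdH M_ge0 leM.
have [->|xH_neq0] := eqVneq (x *m H) 0.
  by rewrite /mxdot !mul0mx mxtrace0 mulr0.
rewrite -mxdot_gt0 in xH_neq0; rewrite -(ler_pM2r xH_neq0) -expr2.
apply: le_trans (psd_cauchy_schwarz x (x *m H) symH psdH) _.
by rewrite (mulrC M) -mulrA ler_wpM2l.
Qed.

(** * Extreme eigenvalues as bounds of the quadratic form *)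

Lemma mxdot_form_le (R : realFieldType) (n : nat) (H : 'M[R]_n) (x : 'rV[R]_n) :
  mxdot (x *m H) x <= (mxdot H H + 1) * mxdot x x.
Proof.
(* Expanding this square bounds twice the form by |xH|^2 + |x|^2. *)
have := mxdot_ge0 (x *m H - x).
rewrite -scaleN1r !(mxdotDl, mxdotDr, mxdotZl, mxdotZr) (mxdotC x (x *m H)).
have : 0 <= mxdot H H * mxdot x x by rewrite mulr_ge0 ?mxdot_ge0.
by have := mxdot_mulmx_le x H; have := mxdot_ge0 x; lra.
Qed.

(* The least l such that l - H is positive semidefinite is an eigenvalue of H:
   otherwise l - H is invertible, hence positive definite with a margin, which
   contradicts the minimality of l. *)
Lemma rayleigh_max (R : realType) (n : nat) (H : 'M[R]_n) :
    (0 < n)%N -> H^T = H ->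
  exists2 l, eigenvalue H l &
    forall x : 'rV[R]_n, mxdot (x *m H) x <= l * mxdot x x.
Proof.
move=> n_gt0 symH.
pose S := [set l | forall x : 'rV[R]_n, mxdot (x *m H) x <= l * mxdot x x].
have S_neq0 : S !=set0.
  by exists (mxdot H H + 1) => x; apply: mxdot_form_le.
have S_lb (x : 'rV[R]_n) : x != 0 ->
    lbound S (mxdot (x *m H) x / mxdot x x).
  by move=> x_neq0 l /(_ x); rewrite ler_pdivrMr // mxdot_gt0.
have S_inf : has_inf S.
  pose e : 'rV[R]_n := const_mx 1; split=> //.
  exists (mxdot (e *m H) e / mxdot e e); apply: S_lb.
  apply/eqP => /matrixP/(_ 0 (Ordinal n_gt0)).
  by rewrite !mxE => /eqP; rewrite oner_eq0.
have infP (x : 'rV[R]_n) : mxdot (x *m H) x <= inf S * mxdot x x.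
  have [->|x_neq0] := eqVneq x 0.
    by rewrite mul0mx /mxdot mul0mx mxtrace0 mulr0.
  by rewrite -ler_pdivrMr ?mxdot_gt0 //; apply: lb_le_inf (S_lb _ x_neq0).
exists (inf S); last exact: infP.
apply: contraT => not_eigen.
pose A := (inf S)%:M - H.
have xAE (x : 'rV[R]_n) :
    mxdot (x *m A) x = inf S * mxdot x x - mxdot (x *m H) x.
  by rewrite mulmxBr mul_mx_scalar -scaleN1r mxdotDl !mxdotZl mulN1r.
have symA : A^T = A by rewrite linearB /= tr_scalar_mx symH.
have psdA (x : 'rV[R]_n) : 0 <= mxdot (x *m A) x by rewrite xAE subr_ge0.
have unitA : A \in unitmx.
  move: not_eigen; rewrite /eigenvalue /eigenspace negbK kermx_eq0.
  by rewrite row_free_unit -opprB -scaleN1r unitmxZ ?unitrN1.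
(* Writing x as (x A) A^-1 gives |x|^2 <= |A^-1|^2 |xA|^2, and [psd_sqr_le] bounds |xA|^2 by the
   form of [A]; the final [+ 1] makes [C] positive. The resulting margin puts [inf S - C^-1] in
   [S]. *)
pose C := mxdot (invmx A) (invmx A) * (mxdot A A + 1) + 1.
have bound (x : 'rV[R]_n) : mxdot x x <= C * mxdot (x *m A) x.
  rewrite mulrDl mul1r ler_wpDr //.
  rewrite -{1 2}(mulmxK unitA x).
  apply: le_trans (mxdot_mulmx_le _ _) _; rewrite -mulrA ler_wpM2l ?mxdot_ge0 //.
  apply: psd_sqr_le => //; first by rewrite addr_ge0 ?mxdot_ge0.
  by move=> z; apply: mxdot_form_le.
have C_gt0 : 0 < C by rewrite ltr_wpDl // mulr_ge0 ?addr_ge0 ?mxdot_ge0.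
suff : inf S <= inf S - C^-1 by rewrite lerBrDr gerDl leNgt invr_gt0 C_gt0.
apply: ge_inf => [|x]; first by case: S_inf.
rewrite mulrBl lerBrDr -lerBrDl -xAE mulrC ler_pdivrMr // mulrC.
exact: bound.
Qed.

Lemma eigenvalue_form (R : realType) (n : nat) (H : 'M[R]_n) (a : R) :
  eigenvalue H a ->
  exists2 v : 'rV[R]_n, v != 0 & mxdot (v *m H) v = a * mxdot v v.
Proof. by case/eigenvalueP => v vH v_neq0; exists v; rewrite // vH mxdotZl. Qed.

(** Evaluated at eigenvectors, the form bound shows that the [l] of [rayleigh_max] dominates every
    eigenvalue, so the supremum is attained at [l]. *)
Lemma lambda_maxP (R : realType) (n : nat) (H : 'M[R]_n) :
    (0 < n)%N -> H^T = H ->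
  eigenvalue H (lambda_max H) /\
  forall x : 'rV[R]_n, mxdot (x *m H) x <= lambda_max H * mxdot x x.
Proof.
move=> n_gt0 symH; have [l l_eig l_max] := rayleigh_max n_gt0 symH.
suff -> : lambda_max H = l by [].
have l_ub : ubound [set a | eigenvalue H a] l.
  move=> a /= /eigenvalue_form[v v_neq0 vE].
  by have := l_max v; rewrite vE ler_pM2r // mxdot_gt0.
apply/eqP; rewrite eq_le; apply/andP; split.
  by apply: ge_sup => //; exists l.
by apply: ub_le_sup => //; exists l.
Qed.

Lemma lambda_minP (R : realType) (n : nat) (H : 'M[R]_n) :
    (0 < n)%N -> H^T = H ->
  eigenvalue H (lambda_min H) /\
  forall x : 'rV[R]_n, lambda_min H * mxdot x x <= mxdot (x *m H) x.
Proof.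
move=> n_gt0 symH.
have eigN a : eigenvalue (- H) a -> eigenvalue H (- a).
  case/eigenvalueP => v vH v_neq0; apply/eigenvalueP; exists v => //.
  by rewrite scaleNr -vH mulmxN opprK.
(* The smallest eigenvalue of [H] is minus the largest one of [- H]. *)
have [|l /eigN l_eig l_max] := @rayleigh_max _ _ (- H) n_gt0.
  by rewrite linearN /= symH.
have l_min (x : 'rV[R]_n) : - l * mxdot x x <= mxdot (x *m H) x.
  rewrite mulNr lerNl -mulN1r -mxdotZl scaleN1r -mulmxN.
  exact: l_max.
suff -> : lambda_min H = - l by [].
have l_lb : lbound [set a | eigenvalue H a] (- l).
  move=> a /= /eigenvalue_form[v v_neq0 vE].
  by have := l_min v; rewrite vE ler_pM2r // mxdot_gt0.
apply/eqP; rewrite eq_le; apply/andP; split; last first.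
  by apply: lb_le_inf => //; exists (- l).
by apply: ge_inf => //; exists (- l).
Qed.

(** * Contraction by one step, and eigenvalues under a rank one update *)

Lemma gradient_step_contraction (R : realType) (p n : nat) (H : 'M[R]_n)
    (r mu sigma : R) (X : 'M[R]_(p, n)) :
    (0 < n)%N -> H^T = H -> 0 < r ->
    r < 2 * lambda_min H / lambda_max H ^+ 2 ->
    0 < mu <= lambda_min H -> lambda_min H <= sigma -> r * sigma < 2 ->
  mxdot (X *m (1%:M - r *: H)) (X *m (1%:M - r *: H)) <=
    (1 - r * ((2 - r * sigma) / 2) * mu) * mxdot X X.
Proof.
move=> n_gt0 symH r_gt0 r_lt /andP[mu_gt0 mu_le] le_sigma sigma_lt.
rewrite mxdot_rows (mxdot_rows X) mulr_sumr; apply: ler_sum => i _.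
rewrite !row_mul; move: (row i X) => x {X i}.
have [_ formM] := lambda_maxP n_gt0 symH.
have [/eigenvalue_form[v v_neq0 vE] formm] := lambda_minP n_gt0 symH.
have le_mM : lambda_min H <= lambda_max H.
  by have := formM v; rewrite vE ler_pM2r // mxdot_gt0.
move: formM formm le_mM r_lt mu_le le_sigma.
set M := lambda_max H; set m := lambda_min H.
move=> formM formm le_mM r_lt mu_le le_sigma {v v_neq0 vE}.
have m_gt0 : 0 < m by apply: lt_le_trans mu_le.
have M_gt0 : 0 < M by apply: lt_le_trans le_mM.
have rM2_lt : r * M ^+ 2 < 2 * m by rewrite -ltr_pdivlMr // exprn_gt0.
have rM_lt2 : r * M < 2.
  by rewrite -(ltr_pM2r M_gt0) -mulrA -expr2 (lt_le_trans rM2_lt) // ler_pM2l.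
(* With u = r M and w = r sigma, u^2 <= 2 w gives 1 + w / 2 >= 1 + u^2 / 4 >= u, the last by (1 - u
   / 2)^2 >= 0. *)
have gap : (2 - r * sigma) / 2 <= 2 - r * M.
  have : (r * M) ^+ 2 <= 2 * (r * sigma).
    have -> : (r * M) ^+ 2 = r * (r * M ^+ 2) by ring.
    rewrite [leRHS]mulrCA ler_pM2l //.
    by apply: le_trans (ltW rM2_lt) _; rewrite ler_pM2l.
  have : 0 < r * M by rewrite mulr_gt0.
  move: rM_lt2; move: (r * M) (r * sigma) => u w; nra.
have psdH (z : 'rV[R]_n) : 0 <= mxdot (z *m H) z.
  by apply: le_trans (formm z); rewrite mulr_ge0 ?mxdot_ge0 // ltW.
have xH_le := psd_sqr_le x symH psdH (ltW M_gt0) formM.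
have mu_form : mu * mxdot x x <= mxdot (x *m H) x.
  by apply: le_trans (formm x); rewrite ler_wpM2r // mxdot_ge0.
rewrite mulmxBr mulmx1 -scalemxAr -scaleNr.
rewrite !(mxdotDl, mxdotDr, mxdotZl, mxdotZr) (mxdotC x (x *m H)).
(* The squared norm of the new row is |x|^2 - 2 r (form) + r^2 |xH|^2. By H^2 <= M H it is at most
   |x|^2 - r (2 - r M) (form), and [step2] bounds the decrease from below. *)
have step1 : r ^+ 2 * mxdot (x *m H) (x *m H) <=
    r ^+ 2 * (M * mxdot (x *m H) x).
  by rewrite ler_wpM2l // sqr_ge0.
have step2 : r * ((2 - r * sigma) / 2) * (mu * mxdot x x) <=
    r * (2 - r * M) * mxdot (x *m H) x.
  apply: ler_pM => //.
  - by rewrite mulr_ge0 ?(ltW r_gt0) // divr_ge0 // subr_ge0 ltW.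
  - by rewrite mulr_ge0 ?mxdot_ge0 // ltW.
  - by rewrite ler_pM2l.
by lra.
Qed.

(** Adding [z *m z^T] adds the square of [x *m z] to the form at [x], which raises both extreme
    eigenvalues. The last bound is interlacing; dimension at least 2 provides a nonzero row killed
    by [z]. *)
Lemma lambda_rank_one_update (R : realType) (n : nat) (S : 'M[R]_n)
    (z : 'cV[R]_n) :
    (0 < n)%N -> S^T = S ->
  [/\ lambda_min S <= lambda_min (z *m z^T + S),
      lambda_max S <= lambda_max (z *m z^T + S) &
      (1 < n)%N -> lambda_min (z *m z^T + S) <= lambda_max S].
Proof.
move=> n_gt0 symS.
have symH : (z *m z^T + S)^T = z *m z^T + S.
  by rewrite linearD /= trmx_mul trmxK symS.
have formE (x : 'rV[R]_n) : mxdot (x *m (z *m z^T + S)) x =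
    mxdot (x *m z) (x *m z) + mxdot (x *m S) x.
  by rewrite mulmxDr mxdotDl mulmxA mxdotMl trmxK.
have [eigS_min formS_min] := lambda_minP n_gt0 symS.
have [eigS_max formS_max] := lambda_maxP n_gt0 symS.
have [eigH_min formH_min] := lambda_minP n_gt0 symH.
have [eigH_max formH_max] := lambda_maxP n_gt0 symH.
split=> [||n_gt1].
- have [v v_neq0 vE] := eigenvalue_form eigH_min.
  rewrite -mxdot_gt0 in v_neq0; rewrite -(ler_pM2r v_neq0) -vE formE.
  by apply: le_trans (formS_min v) _; rewrite lerDr mxdot_ge0.
- have [v v_neq0 vE] := eigenvalue_form eigS_max.
  rewrite -mxdot_gt0 in v_neq0; rewrite -(ler_pM2r v_neq0) -vE.
  by apply: le_trans (formH_max v); rewrite formE lerDr mxdot_ge0.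
(* A nonzero x orthogonal to z sees only S. *)
have ker_neq0 : kermx z != 0.
  rewrite kermx_eq0 -row_leq_rank -ltnNge.
  by apply: leq_ltn_trans n_gt1; apply: rank_leq_col.
pose x := nz_row (kermx z).
have x_neq0 : x != 0 by rewrite nz_row_eq0.
have xz : x *m z = 0 by apply/sub_kermxP/nz_row_sub.
rewrite -mxdot_gt0 in x_neq0; rewrite -(ler_pM2r x_neq0).
apply: le_trans (formH_min x) _.
by rewrite formE xz /mxdot mul0mx mxtrace0 add0r; apply: formS_max.
Qed.

(** * Regressors and the history stack *)

Lemma normalizer_gt0 (R : realType) (q : nat) (rho : R) (z : 'cV[R]_q) :
  0 < rho -> 0 < normalizer rho z.
Proof.
move=> rho_gt0; rewrite sqrtr_gt0 ltr_wpDr // mxE sumr_ge0 // => i _.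
by rewrite mxE -expr2 sqr_ge0.
Qed.

(** The form at an eigenvector [v] is a sum of squares. If it vanished, [v] would be orthogonal to
    all recorded regressors, since normalizing only rescales them by positive factors, and full row
    rank forces [v = 0]. *)
Lemma lambda_min_history_gt0 (R : realType) (q s : nat) (rho : R)
    (zeta : nat -> 'cV[R]_q) (krec : 'I_s -> nat) :
    (0 < q)%N -> 0 < rho -> \rank (history_stack zeta krec) = q ->
  0 < lambda_min (\sum_(j < s) normalized rho (zeta (krec j)) *m
                                 (normalized rho (zeta (krec j)))^T).
Proof.
move=> q_gt0 rho_gt0 rankZ; set S := (X in lambda_min X).
have symS : S^T = S.
  by rewrite raddf_sum /=; apply: eq_bigr => j _; rewrite trmx_mul trmxK.
have [/eigenvalue_form[v v_neq0 vE] _] := lambda_minP q_gt0 symS.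
have formE : mxdot (v *m S) v = \sum_(j < s)
    mxdot (v *m normalized rho (zeta (krec j)))
          (v *m normalized rho (zeta (krec j))).
  rewrite mulmx_sumr /mxdot mulmx_suml raddf_sum /=.
  by apply: eq_bigr => j _; rewrite trmx_mul !mulmxA.
have v_gt0 : 0 < mxdot v v by rewrite mxdot_gt0.
rewrite -(ltr_pM2r v_gt0) mul0r -vE lt_def formE sumr_ge0 ?andbT; last first.
  by move=> j _; apply: mxdot_ge0.
apply: contra v_neq0; rewrite psumr_eq0; last by move=> j _; apply: mxdot_ge0.
move=> /allP v0; have : v *m history_stack zeta krec = 0.
  apply/matrixP => i j; rewrite !ord1 !mxE.
  have := v0 j (mem_index_enum _); rewrite mxdot_eq0 -scalemxAr scaler_eq0.
  rewrite invr_eq0 gt_eqF ?normalizer_gt0 //= => /eqP/matrixP/(_ 0 0).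
  by rewrite !mxE => vz; rewrite -[RHS]vz; apply: eq_bigr => l _; rewrite mxE.
by move/eqP; rewrite mulmx_free_eq0 // /row_free rankZ.
Qed.

(** Dimension 1 forces one local model and an empty [u], so the only entry of the regressor is the
    single weight, which equals 1. *)
Lemma regressor_const (R : realType) (L nU : nat) (a b : 'I_L -> R)
    (u v : 'cV[R]_nU) :
    (L * (nU + 1) = 1)%N -> \sum_(i < L) a i = 1 -> \sum_(i < L) b i = 1 ->
  regressor a u = regressor b v.
Proof.
move=> q1; have /andP[/eqP L1 nU1] : (L == 1%N) && (nU + 1 == 1)%N.
  by rewrite -muln_eq1 q1.
have nU0 : nU = 0%N by apply/eqP; rewrite addn1 in nU1.
subst L nU; rewrite !big_ord1 => a1 b1.
have -> : u = v by apply/matrixP => [[]].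
rewrite /regressor; do 2!congr (_ _); apply/matrixP => i j.
by rewrite !mxE (ord1 i) a1 b1.
Qed.

(** * Scalar recursions *)

Lemma affine_recursion_le (R : realFieldType) (V : nat -> R) (d B : R) :
    0 < d < 1 -> 0 <= B -> (forall n, V n.+1 <= (1 - d) * V n + B) ->
  forall n, V n <= (1 - d) ^+ n * V 0%N + B / d.
Proof.
(* [B / d] is the fixed point of v -> (1 - d) v + B; the distance to it contracts by [1 - d]. *)
move=> /andP[d_gt0 d_lt1] B_ge0 V_le; elim=> [|n IHn].
  by rewrite expr0 mul1r lerDl divr_ge0 // ltW.
apply: le_trans (V_le n) _; rewrite -lerBrDr; have d_le : 0 <= 1 - d by lra.
apply: le_trans (ler_wpM2l d_le IHn) _; rewrite le_eqVlt; apply/orP; left.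
by apply/eqP; rewrite exprS; field; rewrite gt_eqF.
Qed.

Lemma geometric_eventually_le (R : realType) (d v e : R) :
    0 < d < 1 -> 0 < e ->
  exists N, forall n, (N <= n)%N -> (1 - d) ^+ n * v <= e.
Proof.
move=> /andP[d_gt0 d_lt1] e_gt0.
have : geometric v (1 - d) @ \oo --> 0.
  by apply: cvg_geometric; rewrite ger0_norm; lra.
move/cvgr0Pnorm_le/(_ _ e_gt0) => [N _ le_e]; exists N => n /le_e /=.
by rewrite mulrC; apply: le_trans; apply: ler_norm.
Qed.

(** * Comparison of the Frobenius and induced norms *)

Lemma mxdot_tr (R : comNzRingType) (m n : nat) (A B : 'M[R]_(m, n)) :
  mxdot A^T B^T = mxdot A B.
Proof. by rewrite /mxdot trmxK mxtrace_mulC [RHS]mxdotC. Qed.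

(** Young's inequality, from |c A - B|^2 >= 0 divided by [c]. The free weight [c] lets a contraction
    of [A] absorb the factor [1 + c]. *)
Lemma mxdotD_le (R : realFieldType) (m n : nat) (c : R) (A B : 'M[R]_(m, n)) :
  0 < c ->
  mxdot (A + B) (A + B) <= (1 + c) * mxdot A A + (1 + c^-1) * mxdot B B.
Proof.
move=> c_gt0; have := mxdot_ge0 (c *: A - B).
rewrite -scaleN1r !(mxdotDl, mxdotDr, mxdotZl, mxdotZr) (mxdotC B A).
rewrite -(@pmulr_rge0 _ c^-1) ?invr_gt0 // => h; rewrite -subr_ge0.
apply: le_trans h _; rewrite le_eqVlt; apply/orP; left; apply/eqP; field.
by rewrite gt_eqF.
Qed.

Lemma vnorm2_ge0 (R : realType) (n : nat) (v : 'cV[R]_n) : 0 <= vnorm2 v.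
Proof. exact: sqrtr_ge0. Qed.

Lemma vnorm2E (R : realType) (n : nat) (v : 'cV[R]_n) :
  vnorm2 v = Num.sqrt (mxdot v v).
Proof.
by rewrite mxdotE; congr Num.sqrt; apply: eq_bigr => i _; rewrite big_ord1 expr2.
Qed.

Lemma vnorm2_mulmx_le (R : realType) (m n : nat) (A : 'M[R]_(m, n))
    (x : 'cV[R]_n) :
  vnorm2 x <= 1 -> vnorm2 (A *m x) <= Num.sqrt (mxdot A A).
Proof.
rewrite !vnorm2E => x_le1; rewrite ler_wsqrtr // -mxdot_tr trmx_mul.
apply: le_trans (mxdot_mulmx_le _ _) _; rewrite !mxdot_tr.
rewrite -[leRHS]mulr1 ler_wpM2l ?mxdot_ge0 //.
by rewrite -(sqr_sqrtr (mxdot_ge0 x)) expr_le1 ?sqrtr_ge0.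
Qed.

Lemma mxnorm2_le (R : realType) (m n : nat) (A : 'M[R]_(m, n)) :
  mxnorm2 A <= Num.sqrt (mxdot A A).
Proof.
apply: ge_sup => [|_ [x x_le1 <-]]; last exact: vnorm2_mulmx_le.
exists (vnorm2 (A *m 0)); exists 0 => //=.
by rewrite vnorm2E /mxdot mul0mx mxtrace0 sqrtr0 ler01.
Qed.

(** Each of the [n] columns is the image of a unit basis vector, so its Euclidean norm is at most
    [a]. *)
Lemma mxdot_le_mxnorm2 (R : realType) (m n : nat) (A : 'M[R]_(m, n)) (a : R) :
  mxnorm2 A <= a -> mxdot A A <= n%:R * a ^+ 2.
Proof.
move=> A_le; rewrite -mxdot_tr mxdot_rows.
have -> : n%:R * a ^+ 2 = \sum_(i < n) a ^+ 2.
  by rewrite sumr_const card_ord mulr_natl.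
apply: ler_sum => j _; rewrite -tr_col mxdot_tr.
rewrite -(sqr_sqrtr (mxdot_ge0 _)) -vnorm2E.
have colj_le : vnorm2 (col j A) <= a.
  apply: le_trans A_le; apply: ub_le_sup.
    by exists (Num.sqrt (mxdot A A)) => _ [x x_le1 <-]; apply: vnorm2_mulmx_le.
  exists (delta_mx j 0); last by rewrite -colE.
  rewrite /= vnorm2E /mxdot trmx_delta mul_delta_mx /mxtrace (bigD1 j) //=.
  by rewrite mxE !eqxx big1 ?addr0 ?sqrtr1 // => i /negbTE i_j; rewrite mxE i_j.
by rewrite ler_pXn2r ?nnegrE ?vnorm2_ge0 // (le_trans _ colj_le) ?vnorm2_ge0.
Qed.

(** * Error dynamics and the size of the noise *)

Definition noise (R : realType) (ny q s : nat) (rho r : R)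
    (zeta : nat -> 'cV[R]_q) (omega : nat -> 'cV[R]_ny) (krec : 'I_s -> nat)
    (k : nat) : 'M[R]_(ny, q) :=
  let w t := (normalizer rho (zeta t))^-1 *: omega t *m
             (normalized rho (zeta t))^T in
  r *: (w k + \sum_(j < s) w (krec j)).

Lemma error_dynamics (R : realType) (ny q s : nat) (rho r : R)
    (zeta : nat -> 'cV[R]_q) (Phi : 'M[R]_(ny, q)) (y omega : nat -> 'cV[R]_ny)
    (krec : 'I_s -> nat) (k0 k : nat) (Phihat : nat -> 'M[R]_(ny, q)) :
    (forall t, y t = Phi *m zeta t + omega t) ->
    update_law rho zeta y krec r%:M k0 Phihat -> (k0 <= k)%N ->
  Phihat k.+1 - Phi =
    (Phihat k - Phi) *m (1%:M - r *: H2 rho zeta krec k) +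
    noise rho r zeta omega krec k.
Proof.
move=> yE upd k0k; rewrite upd // {upd}.
set X := Phihat k - Phi; pose zb t := normalized rho (zeta t).
pose w t := (normalizer rho (zeta t))^-1 *: omega t *m (zb t)^T.
(* Each correction splits into a part linear in the error and a disturbance part; subtracting it
   gives the noise its positive sign. *)
have errE t : ident_error rho (Phihat k) (zeta t) (y t) *m (zb t)^T *m r%:M =
    r *: (X *m (zb t *m (zb t)^T)) - r *: w t.
  rewrite mul_mx_scalar -scalerBr; congr (_ *: _).
  rewrite mulmxA -mulmxBl; congr (_ *m _).
  rewrite /ident_error yE /zb /normalized -scalemxAr -scalerBr.
  by rewrite mulmxBl opprD addrA.
rewrite (eq_bigr _ (fun j _ => errE (krec j))) errE.
rewrite /H2 /noise mulmxBr mulmx1 -!scalemxAr mulmxDr mulmx_sumr sumrB.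
rewrite -!scaler_sumr !scalerDr !opprB /X.
by rewrite [LHS](AC (1*2*2*1) (1*6*(3*5)*(2*4))) [in RHS]opprD.
Qed.

(** Normalization bounds each entry of the regressor by 1 and each entry of the disturbance by
    [eps / Num.sqrt rho], uniformly in time. *)
Lemma noise_bound (R : realType) (ny q s : nat) (eps rho r : R)
    (zeta : nat -> 'cV[R]_q) (omega : nat -> 'cV[R]_ny) (krec : 'I_s -> nat) :
    0 < rho -> (forall k, vnorm2 (omega k) <= eps) ->
  exists2 B, 0 <= B & forall k, mxdot (noise rho r zeta omega krec k)
                                      (noise rho r zeta omega krec k) <= B.
Proof.
move=> rho_gt0 omega_le; pose D := eps / Num.sqrt rho.
have eps_ge0 : 0 <= eps by apply: le_trans (omega_le 0%N); apply: vnorm2_ge0.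
have sqr_rho : 0 < Num.sqrt rho by rewrite sqrtr_gt0.
have zz_ge0 (z : 'cV[R]_q) : 0 <= (z^T *m z) 0 0.
  by rewrite mxE sumr_ge0 // => i _; rewrite mxE -expr2 sqr_ge0.
have D_ge0 : 0 <= D by rewrite divr_ge0 // ltW.
have zb_le t a : `|normalized rho (zeta t) a 0| <= 1.
  rewrite mxE normrM normfV (gtr0_norm (normalizer_gt0 _ rho_gt0)).
  rewrite ler_pdivrMl ?normalizer_gt0 // mulr1 -sqrtr_sqr ler_wsqrtr //.
  rewrite mxE (bigD1 a) //= mxE -expr2 addrCA lerDl addr_ge0 ?(ltW rho_gt0) //.
  by rewrite sumr_ge0 // => i _; rewrite mxE -expr2 sqr_ge0.
have w_le t i : `|((normalizer rho (zeta t))^-1 *: omega t) i 0| <= D.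
  rewrite mxE normrM normfV (gtr0_norm (normalizer_gt0 _ rho_gt0)) mulrC.
  apply: ler_pM => //; first by rewrite invr_ge0 ltW ?normalizer_gt0.
    apply: le_trans (omega_le t); rewrite vnorm2E -sqrtr_sqr ler_wsqrtr //.
    exact: sqr_entry_le.
  by rewrite lef_pV2 ?posrE ?normalizer_gt0 // ler_wsqrtr // lerDl.
have prod_le t i a : `|((normalizer rho (zeta t))^-1 *: omega t *m
    (normalized rho (zeta t))^T) i a| <= D.
  rewrite mxE big_ord1 normrM -[D]mulr1 ler_pM //.
  by rewrite [X in `|X|]mxE zb_le.
pose E := `|r| * (D + D *+ s).
have E_ge0 : 0 <= E by rewrite mulr_ge0 // addr_ge0 // mulrn_wge0.
exists (\sum_(i < ny) \sum_(j < q) E ^+ 2) => [|k].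
  by do 2![apply: sumr_ge0 => ? _]; rewrite sqr_ge0.
rewrite mxdotE; do 2![apply: ler_sum => ? _].
rewrite -expr2 -real_normK ?num_real //.
rewrite ler_pXn2r ?nnegrE // mxE normrM ler_wpM2l // mxE.
apply: le_trans (ler_normD _ _) _; apply: lerD; first exact: prod_le.
rewrite summxE; apply: le_trans (ler_norm_sum _ _ _) _.
apply: le_trans (ler_sum _ (fun j _ => prod_le _ _ _)) _.
by rewrite sumr_const card_ord.
Qed.

(** * Uniform contraction and decay of the error energy *)

Lemma uniform_contraction (R : realType) (L nU p s : nat)
    (alpha : nat -> 'I_L -> R) (U : nat -> 'cV[R]_nU)
    (zeta : nat -> 'cV[R]_(L * (nU + 1))) (rho r : R)
    (krec : 'I_s -> nat) (K : nat) :
    (forall k, \sum_(i < L) alpha k i = 1) ->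
    (forall k, zeta k = regressor (alpha k) (U k)) -> 0 < rho ->
    \rank (history_stack zeta krec) = (L * (nU + 1))%N -> 0 < r ->
    (forall k, (K <= k)%N ->
       r < 2 * lambda_min (H2 rho zeta krec k)
             / lambda_max (H2 rho zeta krec k) ^+ 2) ->
  exists2 c, 0 < c < 1 & forall k (X : 'M[R]_(p, L * (nU + 1))), (K <= k)%N ->
    mxdot (X *m (1%:M - r *: H2 rho zeta krec k))
          (X *m (1%:M - r *: H2 rho zeta krec k)) <= (1 - c) * mxdot X X.
Proof.
move=> alpha_sum1 zetaE rho_gt0 rankZ r_gt0 r_lt.
(* Without local models the weights would sum to 0 instead of 1. *)
have q_gt0 : (0 < L * (nU + 1))%N.
  rewrite muln_gt0 addn1 andbT lt0n; apply/eqP => L0.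
  move: alpha alpha_sum1 {zetaE}; rewrite L0 => alpha /(_ 0%N).
  by rewrite big_ord0 => /eqP; rewrite eq_sym oner_eq0.
pose S := \sum_(j < s) normalized rho (zeta (krec j)) *m
                         (normalized rho (zeta (krec j)))^T.
have symS : S^T = S.
  by rewrite raddf_sum /=; apply: eq_bigr => j _; rewrite trmx_mul trmxK.
have H2E k : H2 rho zeta krec k =
    normalized rho (zeta k) *m (normalized rho (zeta k))^T + S by [].
have symH k : (H2 rho zeta krec k)^T = H2 rho zeta krec k.
  by rewrite H2E linearD /= trmx_mul trmxK symS.
have mu_gt0 : 0 < lambda_min S by apply: lambda_min_history_gt0.
have mu_le k : lambda_min S <= lambda_min (H2 rho zeta krec k).
  by case: (lambda_rank_one_update (normalized rho (zeta k)) q_gt0 symS).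
have le_min_max (H : 'M[R]_(L * (nU + 1))) : H^T = H ->
    lambda_min H <= lambda_max H.
  move=> HT; have [/eigenvalue_form[v v_neq0 vE] _] := lambda_minP q_gt0 HT.
  have [_ /(_ v)] := lambda_maxP q_gt0 HT.
  by rewrite vE ler_pM2r // mxdot_gt0.
have [sigma [sigma_ge sigma_lt]] : exists sigma,
    (forall k, (K <= k)%N -> lambda_min (H2 rho zeta krec k) <= sigma) /\
    r * sigma < 2.
  have [q_gt1|q_le1] := ltnP 1 (L * (nU + 1)).
    exists (lambda_max S); split=> [k _|].
      have [_ _] := lambda_rank_one_update (normalized rho (zeta k)) q_gt0 symS.
      exact.
    (* Let m and M be the extreme eigenvalues of H2 at time [K]. As m <= sigma <= M, r sigma^2 <= r
       M^2 < 2 m <= 2 sigma. *)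
    have [_ max_le /(_ q_gt1) min_le] :=
      lambda_rank_one_update (normalized rho (zeta K)) q_gt0 symS.
    have max_gt0 := lt_le_trans mu_gt0 (le_min_max _ symS).
    move: (r_lt _ (leqnn K)); rewrite ltr_pdivlMr; last first.
      by rewrite exprn_gt0 // H2E (lt_le_trans max_gt0).
    rewrite H2E => rM_lt; rewrite -(ltr_pM2r max_gt0) -mulrA -expr2.
    apply: le_lt_trans (lt_le_trans rM_lt _); last by rewrite ler_pM2l.
    rewrite ler_pM2l // ler_pXn2r ?nnegrE // ltW //.
    exact: lt_le_trans max_le.
  have q1 : (L * (nU + 1) = 1)%N by apply/eqP; rewrite eqn_leq q_le1.
  have H2_const k : H2 rho zeta krec k = H2 rho zeta krec K.
    have zeta_const :=
      regressor_const (U k) (U K) q1 (alpha_sum1 k) (alpha_sum1 K).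
    by rewrite !H2E !zetaE zeta_const.
  exists (lambda_min (H2 rho zeta krec K)); split=> [k _|].
    by rewrite H2_const.
  have min_gt0 := lt_le_trans mu_gt0 (mu_le K).
  have max_ge := le_min_max _ (symH K).
  move: (r_lt _ (leqnn K)); rewrite ltr_pdivlMr; last first.
    by rewrite exprn_gt0 // (lt_le_trans min_gt0).
  move=> rM_lt; rewrite -(ltr_pM2r min_gt0) -mulrA -expr2.
  apply: le_lt_trans rM_lt; rewrite ler_pM2l // ler_pXn2r ?nnegrE // ltW //.
  exact: lt_le_trans max_ge.
pose c := r * ((2 - r * sigma) / 2) * lambda_min S.
have c_gt0 : 0 < c by rewrite !mulr_gt0 ?invr_gt0 ?subr_gt0.
(* The cap at 1/2 keeps the rate below 1 and only weakens the contraction. *)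
exists (Num.min c (1 / 2)) => [|k X Kk].
  rewrite lt_min c_gt0 gt_min /=.
  by apply/andP; split; last (apply/orP; right); lra.
apply: (@le_trans _ _ ((1 - c) * mxdot X X)).
  apply: gradient_step_contraction => //; [exact: r_lt| |exact: sigma_ge].
  by rewrite mu_gt0 mu_le.
by rewrite ler_wpM2r ?mxdot_ge0 // lerB // ge_min lexx.
Qed.

(** Young's inequality with weight [c] turns the contraction factor [1 - c] into (1 + c) (1 - c) = 1
    - c^2, whence [d = c ^+ 2]. The constants are chosen before the noise level, the initial time
    and the solution, so one bound serves both claims. *)
Lemma error_energy (R : realType) (L nU ny s : nat)
    (alpha : nat -> 'I_L -> R) (U : nat -> 'cV[R]_nU)
    (zeta : nat -> 'cV[R]_(L * (nU + 1)))
    (Phi : 'M[R]_(ny, L * (nU + 1)))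
    (y omega : nat -> 'cV[R]_ny) (rho r : R)
    (krec : 'I_s -> nat) (K : nat) :
    (forall k, \sum_(i < L) alpha k i = 1) ->
    (forall k, zeta k = regressor (alpha k) (U k)) ->
    (forall k, y k = Phi *m zeta k + omega k) -> 0 < rho ->
    \rank (history_stack zeta krec) = (L * (nU + 1))%N -> 0 < r ->
    (forall k, (K <= k)%N ->
       r < 2 * lambda_min (H2 rho zeta krec k)
             / lambda_max (H2 rho zeta krec k) ^+ 2) ->
  exists d C, [/\ 0 < d < 1, 0 <= C & forall B, 0 <= B ->
    (forall k, mxdot (noise rho r zeta omega krec k)
                     (noise rho r zeta omega krec k) <= B) ->
    forall k0 Phihat, (K <= k0)%N -> update_law rho zeta y krec r%:M k0 Phihat ->
    forall n, mxdot (Phihat (n + k0)%N - Phi) (Phihat (n + k0)%N - Phi) <=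
      (1 - d) ^+ n * mxdot (Phihat k0 - Phi) (Phihat k0 - Phi) + C * B].
Proof.
move=> alpha_sum1 zetaE yE rho_gt0 rankZ r_gt0 r_lt.
have [c /andP[c_gt0 c_lt1] contr] :=
  uniform_contraction ny alpha_sum1 zetaE rho_gt0 rankZ r_gt0 r_lt.
have d01 : 0 < c ^+ 2 < 1 by rewrite exprn_gt0 //= expr_lt1 // ltW.
have cV_gt0 : 0 < c^-1 by rewrite invr_gt0.
exists (c ^+ 2), ((1 + c^-1) / c ^+ 2); split=> //.
  by rewrite divr_ge0 ?sqr_ge0 //; lra.
move=> B B_ge0 noise_le k0 Phihat Kk0 upd n; rewrite mulrAC.
pose V n := mxdot (Phihat (n + k0)%N - Phi) (Phihat (n + k0)%N - Phi).
apply: (@affine_recursion_le _ V) => // [|{}n]; first by rewrite mulr_ge0 //; lra.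
rewrite /V addSn (error_dynamics yE upd (leq_addl _ _)).
apply: le_trans (mxdotD_le _ _ c_gt0) _; apply: lerD; last first.
  by rewrite ler_pM2l //; lra.
have -> : 1 - c ^+ 2 = (1 + c) * (1 - c) by ring.
rewrite -mulrA ler_pM2l; last by lra.
by apply: contr; rewrite (leq_trans Kk0) ?leq_addl.
Qed.

(** * Convergence without disturbance, ultimate boundedness with it *)

Theorem theorem1 (R : realType) (L nU ny s : nat)
    (alpha : nat -> 'I_L -> R) (U : nat -> 'cV[R]_nU)
    (zeta : nat -> 'cV[R]_(L * (nU + 1)))
    (Phi : 'M[R]_(ny, L * (nU + 1)))
    (y omega : nat -> 'cV[R]_ny) (eps rho r : R)
    (krec : 'I_s -> nat) (K : nat)
    (alpha_gt0 : forall k i, 0 < alpha k i)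
    (alpha_sum1 : forall k, \sum_(i < L) alpha k i = 1)
    (zetaE : forall k, zeta k = regressor (alpha k) (U k))
    (yE : forall k, y k = Phi *m zeta k + omega k)
    (omega_le : forall k, vnorm2 (omega k) <= eps)
    (rho_gt0 : 0 < rho)
    (krec_past : forall j, (krec j < K)%N)
    (rankZ : \rank (history_stack zeta krec) = (L * (nU + 1))%N)
    (r_gt0 : 0 < r)
    (r_lt : forall k, (K <= k)%N ->
       r < 2 * lambda_min (H2 rho zeta krec k)
             / lambda_max (H2 rho zeta krec k) ^+ 2) :
  ((forall k, omega k = 0) ->
     forall (k0 : nat) (Phihat : nat -> 'M[R]_(ny, L * (nU + 1))),
       (K <= k0)%N -> update_law rho zeta y krec r%:M k0 Phihat ->
       (fun k => Phihat k - Phi) @ \oo --> (0 : 'M[R]_(ny, L * (nU + 1))))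
  /\
  ((exists k, omega k <> 0) ->
     uniformly_ultimately_bounded K
       (fun k0 (X : nat -> 'M[R]_(ny, L * (nU + 1))) =>
          exists2 Phihat, update_law rho zeta y krec r%:M k0 Phihat &
            forall k, X k = Phihat k - Phi)).
Proof.
have [d [C [d01 C_ge0 energy]]] :=
  error_energy alpha_sum1 zetaE yE rho_gt0 rankZ r_gt0 r_lt.
split=> [omega0 k0 Phihat Kk0 upd|_].
  have noise0 k : mxdot (noise rho r zeta omega krec k)
                        (noise rho r zeta omega krec k) <= 0.
    rewrite (_ : noise _ _ _ _ _ _ = 0) ?/mxdot ?mul0mx ?mxtrace0 //.
    rewrite /noise omega0 scaler0 mul0mx add0r big1 ?scaler0 // => j _.
    by rewrite omega0 scaler0 mul0mx.
  have := energy 0 (lexx 0) noise0 k0 Phihat Kk0 upd.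
  set v := mxdot (Phihat k0 - Phi) _; rewrite mulr0 => V_le.
  apply/cvgr0Pnorm_le => e e_gt0.
  have [N N_le] := geometric_eventually_le v d01 (exprn_gt0 2 e_gt0).
  exists (N + k0)%N => // k /= Nk.
  have Ek : ((k - k0) + k0 = k)%N by rewrite subnK // (leq_trans _ Nk) ?leq_addl.
  have Vk : mxdot (Phihat k - Phi) (Phihat k - Phi) <= e ^+ 2.
    rewrite -Ek; apply: le_trans (V_le _) _; rewrite addr0; apply: N_le.
    by rewrite leq_subRL ?(leq_trans _ Nk) ?leq_addl // addnC.
  (* Convergence is in the max norm; the square of each entry is at most the Frobenius energy. *)
  rewrite /Num.norm /= mx_normrE; apply/bigmax_leP.
  split=> [|[i j] _ /=]; first exact: ltW.
  rewrite -(ler_pXn2r (n := 2)) ?nnegrE ?(ltW e_gt0) // real_normK ?num_real //.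
  by apply: le_trans Vk; apply: sqr_entry_le.
have [B B_ge0 noise_le] := noise_bound r zeta krec rho_gt0 omega_le.
have CB_ge0 : 0 <= C * B by rewrite mulr_ge0.
(* [C * B] is the persistent effect of the noise, and 1 bounds the transient after the delay. *)
exists (Num.sqrt (1 + C * B)) => [|a a_gt0].
  by rewrite sqrtr_gt0; lra.
(* The initial energy is at most q a^2 with q the regressor dimension, so the delay depends on [a]
   but not on the initial time. *)
have [T T_le] := geometric_eventually_le ((L * (nU + 1))%:R * a ^+ 2) d01 ltr01.
exists T => k0 X Kk0 [Phihat upd XE] Xk0 k Tk.
have Ek : ((k - k0) + k0 = k)%N by rewrite subnK // (leq_trans _ Tk) ?leq_addr.
apply: le_trans (mxnorm2_le _) _; rewrite ler_wsqrtr // XE -Ek.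
apply: le_trans (energy B B_ge0 noise_le k0 Phihat Kk0 upd _) _.
rewrite lerD2r; apply: le_trans (T_le (k - k0)%N _); last first.
  by rewrite leq_subRL // (leq_trans _ Tk) ?leq_addr.
rewrite ler_wpM2l ?exprn_ge0 ?subr_ge0 //; first by case/andP: d01 => _ /ltW.
by rewrite -XE; apply: mxdot_le_mxnorm2.
Qed.
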